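(* Let $T\ge1$ be an integer and $\delta\ge0$. Consider a streaming algorithm $M$ for Task A (the one-bit stream task defined in the context) on $T$ inputs that has advantage at least $\delta$. Let $M_0,M_1,\dots,M_T$ be the memory states of $M$ when run on i.i.d. uniformly random inputs $X_1,\dots,X_T\in\{0,1\}$. Then $$\widetilde{\mathrm{CI}}(M):=\sum_{t=1}^T I(M_t;X_t\mid M_{t-1})\ \ge\ \frac{\delta^4}{40}.$$
   Context: **Streaming algorithm.** A streaming algorithm $M$ has memory states $M_0,M_1,\dots$ in a finite set. $M_0$ is an initial state, possibly random and independent of the stream. $M_t$ is a (possibly randomized, with fresh independent private randomness, possibly depending on $t$) function of $M_{t-1}$ and the $t$-th stream element $X_t$. The output is a (possibly randomized) function of the final state. $I(\cdot;\cdot\mid\cdot)$ is Shannon conditional mutual information. **Task A (one-bit stream).** The learner $M$ receives a stream of $T$ bits and outputs a value in $\{\text{“U”},\text{“S”}\}$ (“uniform”, “structured”). Its advantage is $$\Pr_{b\sim\mathcal U(\{0,1\}),\ x=(b,b,\dots,b)}[M(x)=\text{“S”}]-\Pr_{x=(x_1,\dots,x_T)\sim\mathcal U(\{0,1\}^T)}[M(x)=\text{“S”}].$$ *)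

(* Defs.v *)
(* Discrete probability over finite types, with real values in an arbitrary
   [realType]. *)
From HB Require Import structures.
From mathcomp Require Import all_boot all_order all_algebra.
From mathcomp Require Import reals exp.

Set Implicit Arguments.
Unset Strict Implicit.
Unset Printing Implicit Defensive.

Import Order.TTheory GRing.Theory Num.Theory.
Local Open Scope ring_scope.

Record fdist (R : realType) (A : finType) := FDist {
  pmf :> A -> R;
  fdist_ge0 : forall a, 0 <= pmf a;
  fdist_sum1 : \sum_(a : A) pmf a = 1 }.

Section Uniform.
Variables (R : realType) (A : finType) (a0 : A).

Let unif (_ : A) : R := #|A|%:R^-1.

Fact uniform_ge0 a : 0 <= unif a.
Proof. by rewrite invr_ge0 ler0n. Qed.

Fact uniform_sum1 : \sum_a unif a = 1.
Proof.
rewrite sumr_const -[_ *+ _]mulr_natr mulVf // pnatr_eq0 -lt0n.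
by apply/card_gt0P; exists a0.
Qed.

(* [a0] only witnesses that [A] is inhabited. *)
Definition uniform : fdist R A := FDist uniform_ge0 uniform_sum1.
End Uniform.

Section Law.
Variables (R : realType) (W A : finType) (P : fdist R W) (f : W -> A).

Let lawf (a : A) : R := \sum_(w | f w == a) P w.

Fact law_ge0 a : 0 <= lawf a.
Proof. by apply: sumr_ge0 => w _; exact: fdist_ge0. Qed.

Fact law_sum1 : \sum_a lawf a = 1.
Proof.
rewrite -[RHS](fdist_sum1 P) [RHS](partition_big f predT) //=.
Qed.

Definition law : fdist R A := FDist law_ge0 law_sum1.
End Law.

(* Information is measured in bits. *)
Definition log2 (R : realType) (x : R) : R := ln x / ln 2%:R.

(* I(X; Y | Z).  Terms with p(x,y,z) = 0 vanish (the convention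
   0 log (0/0) = 0) because of the leading factor; in all other terms the four
   probabilities inside the logarithm are positive. *)
Definition cond_mutual_info (R : realType) (W A B C : finType)
    (P : fdist R W) (X : W -> A) (Y : W -> B) (Z : W -> C) : R :=
  \sum_(a : A) \sum_(b : B) \sum_(c : C)
    let pabc := law P (fun w => (X w, Y w, Z w)) (a, b, c) in
    let pac := law P (fun w => (X w, Z w)) (a, c) in
    let pbc := law P (fun w => (Y w, Z w)) (b, c) in
    let pc := law P Z c in
    pabc * log2 ((pabc * pc) / (pac * pbc)).

(* A streaming algorithm reading [T] elements of [In], with memory states in
   [Mem].  Private randomness, fresh at every step and independent of the
   stream, is represented by transition kernels; the stream element of index
   [t : 'I_T] (counted from 0) triggers the move from M_t to M_(t+1). *)
Record streaming_algorithm (R : realType) (In Mem Out : finType) (T : nat) :=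
  StreamingAlgorithm {
    init : fdist R Mem;
    step : 'I_T -> Mem -> In -> fdist R Mem;
    output : Mem -> fdist R Out }.

(* A run: the stream x_1, ..., x_T and the memory states m_0, ..., m_T. *)
Definition run (In Mem : finType) (T : nat) : finType :=
  ({ffun 'I_T -> In} * {ffun 'I_T.+1 -> Mem})%type.

Definition input_at (In Mem : finType) (T : nat) (t : 'I_T)
    (w : run In Mem T) : In := w.1 t.
Definition mem_before (In Mem : finType) (T : nat) (t : 'I_T)
    (w : run In Mem T) : Mem := w.2 (widen_ord (leqnSn T) t).
Definition mem_after (In Mem : finType) (T : nat) (t : 'I_T)
    (w : run In Mem T) : Mem := w.2 (lift ord0 t).
Definition mem_final (In Mem : finType) (T : nat)
    (w : run In Mem T) : Mem := w.2 ord_max.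

Lemma sum_paths (R : realType) (Mem : finType) (n : nat)
    (p : fdist R Mem) (K : 'I_n -> Mem -> fdist R Mem) :
  \sum_(m : {ffun 'I_n.+1 -> Mem})
    p (m ord0) *
      \prod_(t < n) K t (m (widen_ord (leqnSn n) t)) (m (lift ord0 t)) = 1.
Proof.
elim: n p K => [|n IHn] p K.
  rewrite -[RHS](fdist_sum1 p) (reindex (fun a : Mem => [ffun _ : 'I_1 => a])) /=.
    by apply: eq_bigr => a _; rewrite big_ord0 mulr1 ffunE.
  exists (fun m : {ffun 'I_1 -> Mem} => m ord0) => [a _ | m _].
    by rewrite ffunE.
  by apply/ffunP => i; rewrite ffunE [i]ord1.
pose h (q : Mem * {ffun 'I_n.+1 -> Mem}) : {ffun 'I_n.+2 -> Mem} :=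
  [ffun i => if unlift ord0 i is Some j then q.2 j else q.1].
have h0 q : h q ord0 = q.1 by rewrite ffunE unlift_none.
have hS q j : h q (lift ord0 j) = q.2 j by rewrite ffunE liftK.
rewrite (reindex h) /=; last first.
  exists (fun m => (m ord0, [ffun j => m (lift ord0 j)])) => [[a m] _ | m _].
    by rewrite h0; congr pair; apply/ffunP => j; rewrite ffunE hS.
  by apply/ffunP => i; rewrite ffunE; case: unliftP => [j|] -> //=; rewrite ffunE.
rewrite -(pair_bigA _ (fun a m => p (h (a, m) ord0) *
  \prod_(t < n.+1) K t (h (a, m) (widen_ord (leqnSn n.+1) t))
                       (h (a, m) (lift ord0 t)))) /=.
rewrite -[RHS](fdist_sum1 p); apply: eq_bigr => a _.
rewrite -[RHS]mulr1 -[in RHS](IHn (K ord0 a) (fun t => K (lift ord0 t))) mulr_sumr.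
apply: eq_bigr => m _; rewrite h0 big_ord_recl /=; congr (_ * (_ * _)).
  by rewrite hS (_ : widen_ord _ _ = ord0) ?h0 //; exact: val_inj.
apply: eq_bigr => t _; rewrite hS.
by rewrite (_ : widen_ord _ _ = lift ord0 (widen_ord (leqnSn n) t)) ?hS //;
  exact: val_inj.
Qed.

Section RunLaw.
Variables (R : realType) (In Mem Out : finType) (T : nat).
Variables (M : streaming_algorithm R In Mem Out T)
  (D : fdist R {ffun 'I_T -> In}).

Let run_weight (w : run In Mem T) : R :=
  D w.1 * (init M (w.2 ord0) *
    \prod_(t < T) step M t (mem_before t w) (input_at t w) (mem_after t w)).

Fact run_weight_ge0 w : 0 <= run_weight w.
Proof.
apply: mulr_ge0; first exact: fdist_ge0.
apply: mulr_ge0; first exact: fdist_ge0.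
by apply: prodr_ge0 => t _; exact: fdist_ge0.
Qed.

Fact run_weight_sum1 : \sum_w run_weight w = 1.
Proof.
rewrite -(pair_bigA _ (fun x m => run_weight (x, m))) /=.
rewrite -[RHS](fdist_sum1 D); apply: eq_bigr => x _.
rewrite -[RHS]mulr1 -[in RHS](sum_paths (init M) (fun t a => step M t a (x t))).
by rewrite mulr_sumr.
Qed.

(* The joint law of the stream and all the memory states when the stream is
   drawn from [D]. *)
Definition run_law : fdist R (run In Mem T) :=
  FDist run_weight_ge0 run_weight_sum1.

Definition output_prob (v : Out) : R :=
  \sum_w run_law w * output M (mem_final w) v.
End RunLaw.

Inductive verdict := Unif | Struct.

Definition bool_of_verdict (v : verdict) : bool :=
  if v is Struct then true else false.
Definition verdict_of_bool (b : bool) : verdict := if b then Struct else Unif.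
Fact bool_of_verdictK : cancel bool_of_verdict verdict_of_bool.
Proof. by case. Qed.
HB.instance Definition _ := Finite.copy verdict (can_type bool_of_verdictK).

Definition constant_stream (T : nat) (b : bool) : {ffun 'I_T -> bool} :=
  [ffun _ => b].

Definition uniform_bits (R : realType) (T : nat) : fdist R {ffun 'I_T -> bool} :=
  uniform R (constant_stream T false).

Definition repeated_bit (R : realType) (T : nat) : fdist R {ffun 'I_T -> bool} :=
  law (uniform R false) (constant_stream T).

Definition advantage (R : realType) (Mem : finType) (T : nat)
    (M : streaming_algorithm R bool Mem verdict T) : R :=
  output_prob M (repeated_bit R T) Struct
  - output_prob M (uniform_bits R T) Struct.

(* \sum_t I(M_t; X_t | M_(t-1)), for i.i.d. uniform input bits. *)
Definition info_cost (R : realType) (Mem : finType) (T : nat)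
    (M : streaming_algorithm R bool Mem verdict T) : R :=
  \sum_(t < T) cond_mutual_info (run_law M (uniform_bits R T))
    (@mem_after bool Mem T t) (@input_at bool Mem T t)
    (@mem_before bool Mem T t).

(* Main.v *)
(* Let mu_t and nu_t be the laws of the memory M_t on the fair stream and on the
   constant stream b, and let A_t = \sum_m mu_t(m) nu_t(m) / (mu_t(m) + nu_t(m))
   be their harmonic affinity, so that A_0 = 1/2.  With P and Q the transition
   kernels on a fair bit and on the bit b, one has Q <= 2 P and
     A_(t+1) >= A_t - \sum_c mu_t(c) \sum_a (Q(c,a) - P(c,a))^2 / P(c,a):
   the second-order loss in the expansion of the affinity is weighted by mu_t
   alone, however large nu_t / mu_t is, so no stopping-time argument is needed.
   The total loss V is at most 6 \sum_t I(M_t; X_t | M_(t-1)), because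
   x ln x >= (x - 1) + (x - 1)^2 / 6 on [0, 2].  Finally 1/2 - A_T = Delta / 4 with
   Delta = \sum_m (mu_T - nu_T)^2 / (mu_T + nu_T), and Delta controls the advantage
   on the constant stream b through delta^2 <= Delta / 2 <= 2 V.  This gives
   delta^2 <= 12 \sum_t I(M_t; X_t | M_(t-1)), and delta <= 1. *)
Require Import Defs.
From mathcomp Require Import all_boot all_order all_algebra.
From mathcomp Require Import reals exp ring lra.
Set Implicit Arguments.
Unset Strict Implicit.
Unset Printing Implicit Defensive.
Import Order.TTheory GRing.Theory Num.Theory.
Local Open Scope ring_scope.

(** * Harmonic affinity *)

Section Harmonic.
Variable R : realType.
Implicit Types s t p q x th : R.

Definition harmonic s t := s * t / (s + t).

(* Equality holds at [th = t / (s + t)]: [harmonic] is a minimum of linear forms,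
   hence superadditive. *)
Lemma harmonic_le s t th : 0 <= s -> 0 <= t ->
  harmonic s t <= s * th ^+ 2 + t * (1 - th) ^+ 2.
Proof.
move=> s0 t0; have [st0|st0] := eqVneq (s + t) 0.
  rewrite /harmonic st0 invr0 mulr0.
  by rewrite addr_ge0 // mulr_ge0 // sqr_ge0.
have st_gt0 : 0 < s + t by rewrite lt0r st0 addr_ge0.
rewrite /harmonic ler_pdivrMr //.
have := sqr_ge0 (s * th - t * (1 - th)); nra.
Qed.

Lemma harmonic_sum (I : finType) (s t : I -> R) :
  (forall i, 0 <= s i) -> (forall i, 0 <= t i) ->
  \sum_i harmonic (s i) (t i) <= harmonic (\sum_i s i) (\sum_i t i).
Proof.
move=> s0 t0; set S := \sum_i s i; set U := \sum_i t i.
have S0 : 0 <= S by exact: sumr_ge0.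
have U0 : 0 <= U by exact: sumr_ge0.
have -> : harmonic S U
    = S * (U / (S + U)) ^+ 2 + U * (1 - U / (S + U)) ^+ 2.
  rewrite /harmonic; have [SU0|SU0] := eqVneq (S + U) 0; last by field.
  rewrite SU0 invr0 !mulr0; lra.
rewrite /S /U !mulr_suml -big_split /=.
by apply: ler_sum => i _; exact: harmonic_le.
Qed.

(* First-order expansion of [harmonic] at [(s, t)], scaled by [p]; the term
   linear in [q - p] vanishes once summed over two probability vectors. *)
Lemma harmonic_expand s t p q : 0 <= s -> 0 <= t -> 0 <= p -> 0 <= q ->
  q <= 2 * p ->
  harmonic s t * p + s ^+ 2 * t / (s + t) ^+ 2 * (q - p)
    - s * ((q - p) ^+ 2 / p)
  <= harmonic (s * p) (t * q).
Proof.
move=> s0 t0 p0 q0 qp.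
have [->|sN0] := eqVneq s 0.
  by rewrite /harmonic expr0n /= !mul0r !add0r oppr0.
(* Here [q <= 2 * p] forces [q = 0]; otherwise the loss, read as 0 when [p = 0], could not pay for
   the linear term. *)
have [pE|pN0] := eqVneq p 0.
  have -> : q = 0 by apply/eqP; rewrite eq_le q0 andbT; move: qp; rewrite pE mulr0.
  by rewrite pE /harmonic invr0 !(mulr0, mul0r); lra.
have sp : 0 < s by rewrite lt0r sN0.
have pp : 0 < p by rewrite lt0r pN0.
have st : 0 < s + t by rewrite ltr_pwDl.
have spq : 0 < s * p + t * q by rewrite ltr_pwDl ?mulr_gt0 ?mulr_ge0.
(* This expansion has an exact remainder; its two leading factors are at most 1 and are dropped. *)
have -> : harmonic (s * p) (t * q) = harmonic s t * p
    + s ^+ 2 * t / (s + t) ^+ 2 * (q - p)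
    - (t / (s + t)) ^+ 2 * (s * p / (s * p + t * q)) * (s * ((q - p) ^+ 2 / p)).
  by rewrite /harmonic; field; rewrite pN0 !gt_eqF.
rewrite lerD2l lerN2 ler_piMl //.
  by rewrite mulr_ge0 // divr_ge0 // sqr_ge0.
rewrite mulr_ile1 ?divr_ge0 ?sqr_ge0 ?mulr_ge0 ?(ltW spq) //.
  rewrite expr_le1 ?divr_ge0 ?(ltW st) //.
  by rewrite ler_pdivrMr // mul1r lerDr.
by rewrite ler_pdivrMr // mul1r lerDl mulr_ge0.
Qed.

(* Write [y] for the square root of [x]; [x ln x = 2 y (y ln y) >= 2 y (y - 1)]. *)
Lemma xlnx_ge x : 0 <= x -> x <= 2 -> (x - 1) + (x - 1) ^+ 2 / 6 <= x * ln x.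
Proof.
move=> x0 x2; have [->|xN0] := eqVneq x 0; first by rewrite mul0r; lra.
have xp : 0 < x by rewrite lt0r xN0.
pose y := Num.sqrt x.
have yp : 0 < y by rewrite sqrtr_gt0.
have xE : x = y ^+ 2 by rewrite sqr_sqrtr.
have lny : 1 - y^-1 <= ln y.
  rewrite -[y in ln y]invrK lnV ?posrE ?invr_gt0 // -opprB lerN2.
  have := @le_ln1Dx R (y^-1 - 1); rewrite addrCA subrr addr0; apply.
  by rewrite ltrBDr addNr invr_gt0.
have -> : x * ln x = 2 * y * (y * ln y) by rewrite xE lnXn // -mulr_natl; ring.
have y1 : y - 1 <= y * ln y.
  by have := ler_wpM2l (ltW yp) lny; rewrite mulrBr mulr1 divff ?gt_eqF.
have : 2 * y * (y - 1) <= 2 * y * (y * ln y) by rewrite ler_wpM2l // mulr_ge0 // ltW.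
apply: le_trans; rewrite xE.
(* Source of the 6: [2 * y <= y ^+ 2 + 1 <= 3]. It suffices because [2 * y * (y - 1)] is
   [(x - 1) + (y - 1) ^+ 2]. *)
have h : (y + 1) ^+ 2 <= 6 by have := sqr_ge0 (y - 1); rewrite xE in x2; nra.
have := ler_wpM2l (sqr_ge0 (y - 1)) h; nra.
Qed.

Lemma ln2_gt0 : 0 < ln (2 : R).
Proof. by rewrite ln_gt0 // ltr1n. Qed.

Lemma ln2_le1 : ln (2 : R) <= 1.
Proof. by apply: (@le_ln1Dx R 1); exact: lt_trans (ltrN10 _) ltr01. Qed.

(** One summand of the mutual information, bounded by [xlnx_ge] at the likelihood ratio [q / p]. The
    linear part is kept because it cancels between the two bits. *)
Lemma info_term_ge m p q : 0 <= m -> 0 <= p -> 0 <= q -> q <= 2 * p ->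
  m / 2 * ((q - p) + (q - p) ^+ 2 / p / 6) / ln 2
  <= m / 2 * q * log2 ((m / 2 * q * m) / ((m * p) * (m / 2))).
Proof.
move=> m0 p0 q0 qp; have [->|mN0] := eqVneq m 0; first by rewrite !mul0r.
rewrite /log2 [leRHS]mulrA ler_wpM2r ?invr_ge0 ?(ltW ln2_gt0) //.
have [pE|pN0] := eqVneq p 0.
  have -> : q = 0 by apply/eqP; rewrite eq_le q0 andbT; move: qp; rewrite pE mulr0.
  by rewrite pE invr0 !(mulr0, mul0r) subrr addr0 mulr0.
have pp : 0 < p by rewrite lt0r pN0.
have -> : m / 2 * q * m / (m * p * (m / 2)) = q / p by field; rewrite pN0.
rewrite -[leRHS]mulrA ler_wpM2l ?divr_ge0 //.
have -> : q * ln (q / p) = p * (q / p * ln (q / p)) by field.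
have -> : q - p + (q - p) ^+ 2 / p / 6 = p * ((q / p - 1) + (q / p - 1) ^+ 2 / 6).
  by field.
by rewrite ler_wpM2l // xlnx_ge ?divr_ge0 // ler_pdivrMr.
Qed.
End Harmonic.

(** * Weights of memory paths *)

Lemma ffun_sum_recr (V : nmodType) (A : finType) n (F : {ffun 'I_n.+1 -> A} -> V) :
  \sum_f F f = \sum_(g : {ffun 'I_n -> A}) \sum_a
    F [ffun i => oapp g a (unlift ord_max i)].
Proof.
rewrite pair_bigA /=.
pose h (q : {ffun 'I_n -> A} * A) : {ffun 'I_n.+1 -> A} :=
  [ffun i => oapp q.1 q.2 (unlift ord_max i)].
rewrite (reindex h) //=.
exists (fun f => ([ffun j => f (lift ord_max j)], f ord_max)) => [[g a] _|f _].
  congr pair; last by rewrite ffunE unlift_none.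
  by apply/ffunP => j; rewrite !ffunE liftK.
apply/ffunP => i; rewrite ffunE /=.
by case: unliftP => [j ->|->] //=; rewrite ffunE.
Qed.

Section Paths.
Variables (R : realType) (In Mem : finType).

(** [K t c b a] weighs reading [b] and moving to [a] jointly, so that an independent stream is
    absorbed into the kernel. *)
Definition path_weight n (p : Mem -> R) (K : 'I_n -> Mem -> In -> Mem -> R)
    (w : run In Mem n) : R :=
  p (w.2 ord0) *
    \prod_(t < n) K t (mem_before t w) (input_at t w) (mem_after t w).

Definition state_weight n (p : Mem -> R) (K : 'I_n -> Mem -> In -> Mem -> R)
    (i : 'I_n.+1) (c : Mem) : R :=
  \sum_(w : run In Mem n | w.2 i == c) path_weight p K w.

(** * Splitting off the last step of a run *)

Definition rcons_run n (w : run In Mem n) (b : In) (a : Mem)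
    : run In Mem n.+1 :=
  ([ffun i => oapp w.1 b (unlift ord_max i)],
   [ffun i => oapp w.2 a (unlift ord_max i)]).

Lemma run_sum_recr n (F : run In Mem n.+1 -> R) :
  \sum_w F w = \sum_(w : run In Mem n) \sum_b \sum_a F (rcons_run w b a).
Proof.
rewrite [LHS](eq_bigr (fun w => F (w.1, w.2))); last by case.
rewrite [RHS](eq_bigr (fun w => \sum_b \sum_a F (rcons_run (w.1, w.2) b a))); last by case.
rewrite -(pair_bigA _ (fun x m => F (x, m))) /= ffun_sum_recr.
rewrite -(pair_bigA _ (fun x m => \sum_b \sum_a F (rcons_run (x, m) b a))) /=.
apply: eq_bigr => x _; rewrite [RHS]exchange_big /=; apply: eq_bigr => b _.
by rewrite ffun_sum_recr.
Qed.

Section Rcons.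
Variables (n : nat) (w : run In Mem n) (b : In) (a : Mem).

Lemma rcons_run_state (i : 'I_n.+1) :
  (rcons_run w b a).2 (widen_ord (leqnSn n.+1) i) = w.2 i.
Proof.
rewrite ffunE (_ : widen_ord _ _ = lift ord_max i) ?liftK //.
by apply: val_inj; rewrite /= /bump leqNgt ltn_ord.
Qed.

Lemma rcons_run_final : (rcons_run w b a).2 ord_max = a.
Proof. by rewrite ffunE unlift_none. Qed.

Lemma rcons_run_input (t : 'I_n) :
  input_at (widen_ord (leqnSn n) t) (rcons_run w b a) = input_at t w.
Proof.
rewrite /input_at ffunE (_ : widen_ord _ _ = lift ord_max t) ?liftK //.
by apply: val_inj; rewrite /= /bump leqNgt ltn_ord.
Qed.

Lemma rcons_run_input_last : input_at ord_max (rcons_run w b a) = b.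
Proof. by rewrite /input_at ffunE unlift_none. Qed.

Lemma rcons_run_before (t : 'I_n) :
  mem_before (widen_ord (leqnSn n) t) (rcons_run w b a) = mem_before t w.
Proof.
rewrite /mem_before -rcons_run_state; congr (fun_of_fin _ _); exact: val_inj.
Qed.

Lemma rcons_run_after (t : 'I_n) :
  mem_after (widen_ord (leqnSn n) t) (rcons_run w b a) = mem_after t w.
Proof.
rewrite /mem_after -rcons_run_state; congr (fun_of_fin _ _); exact: val_inj.
Qed.

Lemma rcons_run_before_last :
  mem_before ord_max (rcons_run w b a) = w.2 ord_max.
Proof.
rewrite /mem_before -rcons_run_state; congr (fun_of_fin _ _); exact: val_inj.
Qed.

Lemma rcons_run_after_last : mem_after ord_max (rcons_run w b a) = a.
Proof.
rewrite /mem_after (_ : lift _ _ = ord_max) ?rcons_run_final //.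
exact: val_inj.
Qed.

Lemma path_weight_rcons (p : Mem -> R) (K : 'I_n.+1 -> Mem -> In -> Mem -> R) :
  path_weight p K (rcons_run w b a) =
  path_weight p (fun t => K (widen_ord (leqnSn n) t)) w
    * K ord_max (w.2 ord_max) b a.
Proof.
rewrite /path_weight big_ord_recr /= mulrA rcons_run_before_last.
rewrite rcons_run_input_last rcons_run_after_last.
congr (_ * _ * _).
  congr (p _); rewrite -rcons_run_state.
  by congr (fun_of_fin _ _); exact: val_inj.
apply: eq_bigr => t _.
by rewrite rcons_run_before rcons_run_input rcons_run_after.
Qed.
End Rcons.

Definition stochastic n (K : 'I_n -> Mem -> In -> Mem -> R) :=
  forall t c, \sum_b \sum_a K t c b a = 1.

(** The event ignores the last step, whose factor sums to 1; iterating this reduces marginals to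
    shorter runs. *)
Lemma run_sum_prefix n p (K : 'I_n.+1 -> Mem -> In -> Mem -> R)
    (Pw : pred (run In Mem n.+1)) (Pv : pred (run In Mem n)) :
  stochastic K -> (forall w b a, Pw (rcons_run w b a) = Pv w) ->
  \sum_(w | Pw w) path_weight p K w =
  \sum_(w | Pv w) path_weight p (fun t => K (widen_ord (leqnSn n) t)) w.
Proof.
move=> K1 PE; rewrite big_mkcond run_sum_recr [RHS]big_mkcond /=.
apply: eq_bigr => w _.
under eq_bigr => b _ do under eq_bigr => a _ do rewrite PE.
case: (Pv w); last by rewrite big1 // => b _; rewrite big1.
rewrite -[RHS]mulr1 -(K1 ord_max (w.2 ord_max)) mulr_sumr.
apply: eq_bigr => b _; rewrite mulr_sumr; apply: eq_bigr => a _.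
by rewrite path_weight_rcons.
Qed.

Lemma state_weight0 n p (K : 'I_n -> Mem -> In -> Mem -> R) c :
  stochastic K -> state_weight p K ord0 c = p c.
Proof.
elim: n K => [|n IHn] K K1; last first.
  rewrite -(IHn (fun t => K (widen_ord (leqnSn n) t))) //.
  apply: run_sum_prefix => // w b a; rewrite -(rcons_run_state w b a ord0).
  by congr (_ == _); congr (fun_of_fin _ _); exact: val_inj.
pose w0 : run In Mem 0 := (ffun0 (card_ord 0), [ffun=> c]).
rewrite /state_weight (big_pred1 w0) => [|[x m]].
  by rewrite /path_weight big_ord0 mulr1 ffunE.
rewrite /= /w0 xpair_eqE; apply/eqP/andP => [mc|[_ /eqP->]]; last by rewrite ffunE.
split; apply/eqP/ffunP => i; first by case: i.
by rewrite ffunE [i]ord1.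
Qed.

(** Induction on time: [widen_ord _ t] and [lift ord0 t] index the memory before and after step
    [t]. *)
Lemma ord_step_ind n (P : 'I_n.+1 -> Prop) :
  P ord0 ->
  (forall t : 'I_n, P (widen_ord (leqnSn n) t) -> P (lift ord0 t)) ->
  forall i, P i.
Proof.
move=> P0 PS [k]; elim: k => [|k IHk] lt_k_n.
  by rewrite (_ : Ordinal _ = ord0) //; exact: val_inj.
have lt_k : (k < n)%N by [].
rewrite (_ : Ordinal _ = lift ord0 (Ordinal lt_k)); last exact: val_inj.
apply: PS; rewrite (_ : widen_ord _ _ = Ordinal (ltnW lt_k_n)) //.
exact: val_inj.
Qed.

(** Markov property: later steps are summed out one by one until [t] is the last step, whose factor
    is then [K t c b a]. *)
Lemma joint_weight n p (K : 'I_n -> Mem -> In -> Mem -> R) t a b c :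
  stochastic K ->
  \sum_(w | (mem_after t w, input_at t w, mem_before t w) == (a, b, c))
    path_weight p K w
  = state_weight p K (widen_ord (leqnSn n) t) c * K t c b a.
Proof.
elim: n K t => [|n IHn] K t K1; first by case: t.
have [s ->|tE] : unlift_spec ord_max t (unlift ord_max t) by exact: unliftP.
  have -> : lift ord_max s = widen_ord (leqnSn n) s.
    by apply: val_inj; rewrite /= /bump leqNgt ltn_ord.
  rewrite (@run_sum_prefix _ _ _ _ (fun w =>
    (mem_after s w, input_at s w, mem_before s w) == (a, b, c))) //; last first.
    by move=> w b' a'; rewrite rcons_run_after rcons_run_input rcons_run_before.
  rewrite IHn //; congr (_ * _); apply/esym.
  apply: run_sum_prefix => // w b' a'; rewrite -(rcons_run_state w b' a').
  by congr (_ == _); congr (fun_of_fin _ _); exact: val_inj.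
rewrite tE.
have -> : state_weight p K (widen_ord (leqnSn n.+1) ord_max) c =
    state_weight p (fun t => K (widen_ord (leqnSn n) t)) ord_max c.
  by apply: run_sum_prefix => // w b' a'; rewrite rcons_run_state.
rewrite big_mkcond run_sum_recr /state_weight mulr_suml [RHS]big_mkcond /=.
apply: eq_bigr => w _.
under eq_bigr => b' _ do under eq_bigr => a' _ do
  rewrite rcons_run_after_last rcons_run_input_last rcons_run_before_last
    path_weight_rcons 2!xpair_eqE.
rewrite (bigD1 b) //= (bigD1 a) //= !eqxx /=.
rewrite [X in _ + X + _]big1 => [|a' /negPf->]; last by [].
rewrite [X in _ + _ + X]big1 => [|b' /negPf bb'].
  by rewrite !addr0; case: eqP => [->|].
by rewrite big1 // => a' _; rewrite bb' andbF.
Qed.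

Lemma state_weightS n p (K : 'I_n -> Mem -> In -> Mem -> R) (t : 'I_n) a :
  stochastic K ->
  state_weight p K (lift ord0 t) a =
  \sum_c state_weight p K (widen_ord (leqnSn n) t) c * \sum_b K t c b a.
Proof.
move=> K1; rewrite /state_weight [LHS](partition_big (mem_before t) predT) //=.
apply: eq_bigr => c _; rewrite mulr_sumr.
rewrite (partition_big (input_at t) predT) //=.
apply: eq_bigr => b _; rewrite -joint_weight //; apply: eq_bigl => w.
rewrite 2!xpair_eqE /mem_after.
by case: (_ == a); case: (_ == b); case: (_ == c).
Qed.

End Paths.

(** * The one-bit task *)

(** Superadditivity reduces to separate pairs [(i, j)]; there [harmonic_expand] applies, and its
    linear terms cancel over [j] since both rows sum to 1. *)
Lemma harmonic_sum_step (R : realType) (I : finType) (p q : I -> R)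
    (P Q : I -> I -> R) :
  (forall i, 0 <= p i) -> (forall i, 0 <= q i) ->
  (forall i j, 0 <= P i j) -> (forall i j, 0 <= Q i j) ->
  (forall i j, Q i j <= 2 * P i j) ->
  (forall i, \sum_j P i j = 1) -> (forall i, \sum_j Q i j = 1) ->
  \sum_i harmonic (p i) (q i)
    - \sum_i p i * \sum_j (Q i j - P i j) ^+ 2 / P i j
  <= \sum_j harmonic (\sum_i p i * P i j) (\sum_i q i * Q i j).
Proof.
move=> p0 q0 P0 Q0 QP P1 Q1.
apply: (@le_trans _ _ (\sum_j \sum_i harmonic (p i * P i j) (q i * Q i j))).
  rewrite exchange_big -sumrB; apply: ler_sum => i _ /=.
  apply: le_trans (ler_sum _ (fun j _ => harmonic_expand
    (p0 i) (q0 i) (P0 i j) (Q0 i j) (QP i j))).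
  rewrite sumrB big_split /= -!mulr_sumr sumrB P1 Q1.
  by rewrite subrr mulr0 mulr1 addr0.
by apply: ler_sum => j _; apply: harmonic_sum => i; rewrite mulr_ge0.
Qed.

(* [l d^2 / s + s / (16 l) >= y d] for [|y| <= 1/2], with [s = u + v], [d = v - u];
   [u + v - 4 harmonic u v] is [d^2 / s]. *)
Lemma test_gap_pointwise (R : realType) (l u v x : R) :
  0 < l -> 0 <= u -> 0 <= v -> 0 <= x <= 1 ->
  (x - 2^-1) * (v - u) <= l * (u + v - 4 * harmonic u v) + (u + v) / (16 * l).
Proof.
move=> l0 u0 v0 /andP[x0 x1].
have [s0|s0] := eqVneq (u + v) 0.
  have [-> ->] : u = 0 /\ v = 0 by split; lra.
  by rewrite /harmonic !(mul0r, mulr0, addr0, subr0).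
have sp : 0 < u + v by rewrite lt0r s0 addr_ge0.
have -> : u + v - 4 * harmonic u v = (v - u) ^+ 2 / (u + v).
  by rewrite /harmonic; field.
set y := x - 2^-1; have y4 : 4 * y ^+ 2 <= 1 by rewrite /y; nra.
rewrite -subr_ge0.
(* Completing the square in [v - u]; the leftover is nonnegative because [y] lies within 1/2 of
   0. *)
have -> : l * ((v - u) ^+ 2 / (u + v)) + (u + v) / (16 * l) - y * (v - u)
   = ((l * (v - u) - y * (u + v) / 2) ^+ 2
      + (1 - 4 * y ^+ 2) * (u + v) ^+ 2 / 16) / (l * (u + v)).
  by field; rewrite s0 gt_eqF.
apply: divr_ge0; last by rewrite mulr_ge0 // ltW.
rewrite addr_ge0 ?sqr_ge0 // divr_ge0 // mulr_ge0 ?sqr_ge0 //.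
by rewrite subr_ge0.
Qed.

(** Equal masses allow centering [f] at 1/2. The free parameter [l] replaces the square root of
    Cauchy-Schwarz and is chosen at the end. *)
Lemma test_gap (R : realType) (I : finType) (u v f : I -> R) (V l : R) :
  0 < l -> (forall i, 0 <= u i) -> (forall i, 0 <= v i) ->
  (forall i, 0 <= f i <= 1) -> \sum_i u i = 1 -> \sum_i v i = 1 ->
  2^-1 - V <= \sum_i harmonic (u i) (v i) ->
  \sum_i v i * f i - \sum_i u i * f i <= 4 * l * V + (8 * l)^-1.
Proof.
move=> l0 u0 v0 f01 u1 v1 H.
have E : \sum_i v i * f i - \sum_i u i * f i
    = \sum_i (f i - 2^-1) * (v i - u i).
  transitivity (\sum_i (v i * f i - u i * f i) - 2^-1 * (\sum_i (v i - u i))).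
    by rewrite !sumrB u1 v1 subrr mulr0 subr0.
  by rewrite mulr_sumr -sumrB; apply: eq_bigr => i _; ring.
rewrite E; apply: le_trans (ler_sum _ (fun i _ =>
  test_gap_pointwise l0 (u0 i) (v0 i) (f01 i))) _.
rewrite big_split /= -mulr_sumr -mulr_suml sumrB -mulr_sumr big_split /= u1 v1.
have -> : (1 + 1) / (16 * l) = (8 * l)^-1 by field; rewrite gt_eqF.
rewrite lerD2r mulrAC -mulrA; have := ler_wpM2l (ltW l0) H; lra.
Qed.

Section OneBit.
Variables (R : realType) (Mem : finType) (T : nat).
Variable M : streaming_algorithm R bool Mem verdict T.

(** A constant stream is also i.i.d., with a point mass as bit law [beta], so one kernel serves both
    kinds of stream. *)
Definition bit_kernel (beta : bool -> R) (t : 'I_T) (c : Mem) (b : bool)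
    (a : Mem) : R := beta b * step M t c b a.

Notation fair := (fun _ : bool => 2^-1 : R).
Notation const b0 := (fun b : bool => (b == b0)%:R : R).
Notation mu beta := (state_weight (init M) (bit_kernel beta)).

Definition mean_step (t : 'I_T) (c a : Mem) : R :=
  \sum_b 2^-1 * step M t c b a.

Lemma stochastic_bit beta : \sum_b beta b = 1 -> stochastic (bit_kernel beta).
Proof.
move=> beta1 t c; rewrite -beta1; apply: eq_bigr => b _.
by rewrite -mulr_sumr fdist_sum1 mulr1.
Qed.

Lemma sum_fair : \sum_b fair b = 1.
Proof. by rewrite big_bool /=; lra. Qed.

Lemma sum_const b0 : \sum_b const b0 b = 1.
Proof. by rewrite big_bool /=; case: b0; rewrite /= ?addr0 ?add0r. Qed.

Lemma fair_ge0 b : 0 <= fair b.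
Proof. by rewrite invr_ge0 ler0n. Qed.

Lemma const_ge0 b0 b : 0 <= const b0 b.
Proof. exact: ler0n. Qed.

Lemma mu_ge0 beta i c : (forall b, 0 <= beta b) -> 0 <= mu beta i c.
Proof.
move=> beta0; apply: sumr_ge0 => w _; rewrite mulr_ge0 ?fdist_ge0 //.
by apply: prodr_ge0 => t _; rewrite mulr_ge0 ?fdist_ge0.
Qed.

Lemma mu_sum1 beta i : \sum_b beta b = 1 -> \sum_c mu beta i c = 1.
Proof.
move=> /stochastic_bit K1; elim/ord_step_ind: i => [|t IHt].
  by under eq_bigr do rewrite state_weight0 //; exact: fdist_sum1.
under eq_bigr do rewrite state_weightS //.
rewrite exchange_big -[RHS]IHt; apply: eq_bigr => c _ /=.
by rewrite -mulr_sumr exchange_big /= K1 mulr1.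
Qed.

(** * The two stream laws and the advantage in terms of path weights *)

Lemma path_bit_prod beta (w : run bool Mem T) :
  path_weight (init M) (bit_kernel beta) w =
  (\prod_t beta (w.1 t)) * (init M (w.2 ord0) *
    \prod_(t < T) step M t (mem_before t w) (input_at t w) (mem_after t w)).
Proof. by rewrite /path_weight big_split /= mulrCA. Qed.

Lemma run_law_uniform w :
  run_law M (uniform_bits R T) w = path_weight (init M) (bit_kernel fair) w.
Proof.
rewrite path_bit_prod /=; congr (_ * _).
by rewrite card_ffun card_bool card_ord prodr_const card_ord natrX exprVn.
Qed.

Lemma run_law_repeated w :
  run_law M (repeated_bit R T) w =
  2^-1 * \sum_b path_weight (init M) (bit_kernel (const b)) w.
Proof.
under eq_bigr do rewrite path_bit_prod.
rewrite -mulr_suml [RHS]mulrA /=; congr (_ * _).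
rewrite big_mkcond mulr_sumr /=; apply: eq_bigr => b _.
rewrite card_bool; have [<-|ne] := eqVneq.
  by rewrite big1 ?mulr1 // => t _; rewrite ffunE eqxx.
(* A stream other than the constant [b] has a position where the point mass vanishes, which kills
   the product. *)
have [t tb] : exists t, w.1 t != b.
  apply/existsP; apply: contraNT ne => /existsPn bw.
  by apply/eqP/ffunP => t; rewrite ffunE; apply/esym/eqP; have := bw t; rewrite negbK.
by rewrite (bigD1 t) //= (negPf tb) mul0r mulr0.
Qed.

Lemma path_weight_state_sum beta i (g : Mem -> R) :
  \sum_w path_weight (init M) (bit_kernel beta) w * g (w.2 i)
  = \sum_c mu beta i c * g c.
Proof.
rewrite (partition_big (fun w : run bool Mem T => w.2 i) predT) //=.
apply: eq_bigr => c _; rewrite mulr_suml.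
by apply: eq_bigr => w /eqP ->.
Qed.

Lemma advantageE : advantage M =
  2^-1 * \sum_b (\sum_c mu (const b) ord_max c * output M c Struct
               - \sum_c mu fair ord_max c * output M c Struct).
Proof.
rewrite /advantage /output_prob.
under eq_bigr do rewrite run_law_repeated -mulrA mulr_suml.
under [X in _ - X]eq_bigr do rewrite run_law_uniform.
rewrite -mulr_sumr exchange_big /=.
under eq_bigr do rewrite (path_weight_state_sum _ _ (fun c => output M c Struct)).
rewrite (path_weight_state_sum _ _ (fun c => output M c Struct)).
by rewrite sumrB sumr_const card_bool; lra.
Qed.

(** Chi-square divergence of the kernel on bit [b] from the fair one, averaged over the fair-stream
    memory: the loss at step [t], with sum V. *)
Definition chi_cost b t : R :=
  \sum_c mu fair (widen_ord (leqnSn T) t) c *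
    \sum_a (step M t c b a - mean_step t c a) ^+ 2 / mean_step t c a.

Lemma mean_step_ge0 t c a : 0 <= mean_step t c a.
Proof. by apply: sumr_ge0 => b _; rewrite mulr_ge0 ?invr_ge0 ?ler0n ?fdist_ge0. Qed.

Lemma step_le_mean t c b a : step M t c b a <= 2 * mean_step t c a.
Proof.
have := fdist_ge0 (step M t c true) a; have := fdist_ge0 (step M t c false) a.
by rewrite /mean_step big_bool /=; case: b; lra.
Qed.

Lemma chi_cost_ge0 b t : 0 <= chi_cost b t.
Proof.
apply: sumr_ge0 => c _; apply: mulr_ge0; first exact: mu_ge0 fair_ge0.
apply: sumr_ge0 => a _.
by rewrite divr_ge0 ?sqr_ge0 ?mean_step_ge0.
Qed.

Lemma harmonic_states_ge b (i : 'I_T.+1) :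
  2^-1 - \sum_(t < T | (t < i)%N) chi_cost b t
  <= \sum_c harmonic (mu fair i c) (mu (const b) i c).
Proof.
have Ku := stochastic_bit sum_fair; have Kb := stochastic_bit (sum_const b).
elim/ord_step_ind: i => [|t IHt].
  rewrite big_pred0 ?subr0 //.
  rewrite [leLHS](_ : _ = \sum_c init M c / 2); last first.
    by rewrite -mulr_suml fdist_sum1 mul1r.
  apply: ler_sum => c _; rewrite !state_weight0 // /harmonic.
  (* Both streams start from [init M], and the harmonic affinity of a weight with itself is half of
     it. *)
  have [->|c0] := eqVneq (init M c) 0; first by rewrite !mul0r.
  have -> // : init M c / 2 = init M c * init M c / (init M c + init M c).
  by rewrite -mulr2n -mulr_natl; field.
have -> : \sum_(s < T | (s < lift ord0 t)%N) chi_cost b s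
    = chi_cost b t + \sum_(s < T | (s < t)%N) chi_cost b s.
  rewrite (bigD1 t) /= ?bump0 //=; congr (_ + _).
  by apply: eq_bigl => s; rewrite /= /bump leq0n add1n ltnS [in RHS]ltn_neqAle andbC.
have step_const c a : \sum_b' bit_kernel (const b) t c b' a = step M t c b a.
  by rewrite /bit_kernel big_bool /=; case: (b); rewrite /= !(mul0r, mul1r, addr0, add0r).
under [leRHS]eq_bigr => a _ do rewrite !state_weightS //.
under [leRHS]eq_bigr => a _ do (under [X in harmonic _ X]eq_bigr => c _ do rewrite step_const).
apply: le_trans (harmonic_sum_step _ _ _ _ _ _ _).
- by move: IHt; rewrite /= /chi_cost /mean_step /bit_kernel; lra.
- by move=> c; exact: mu_ge0 fair_ge0.
- by move=> c; apply: mu_ge0; exact: const_ge0.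
- exact: mean_step_ge0.
- by move=> c a; exact: fdist_ge0.
- by move=> c a; exact: step_le_mean.
- by move=> c; rewrite exchange_big; exact: Ku.
- by move=> c; exact: fdist_sum1.
Qed.

(** The fair-stream marginals factor through [m], [step] and [mean_step], so each summand has the
    form treated in [info_term_ge]. *)
Lemma cond_mutual_info_ge b t :
  chi_cost b t / 6 <= cond_mutual_info (run_law M (uniform_bits R T))
    (@mem_after bool Mem T t) (@input_at bool Mem T t)
    (@mem_before bool Mem T t).
Proof.
have Ku := stochastic_bit sum_fair.
set m := mu fair (widen_ord (leqnSn T) t).
have lawE A (f : run bool Mem T -> A : finType) x :
    law (run_law M (uniform_bits R T)) f x =
    \sum_(w | f w == x) path_weight (init M) (bit_kernel fair) w.
  by apply: eq_bigr => w _; exact: run_law_uniform.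
have abcE a b' c : law (run_law M (uniform_bits R T))
    (fun w => (mem_after t w, input_at t w, mem_before t w)) (a, b', c)
    = m c / 2 * step M t c b' a.
  by rewrite lawE joint_weight // /bit_kernel mulrA.
have acE a c : law (run_law M (uniform_bits R T))
    (fun w => (mem_after t w, mem_before t w)) (a, c) = m c * mean_step t c a.
  rewrite lawE (partition_big (input_at t) predT) //= /mean_step mulr_sumr.
  apply: eq_bigr => b' _; rewrite mulrA -abcE lawE; apply: eq_bigl => w.
  rewrite !xpair_eqE.
  by case: (_ == a); case: (_ == c); case: (_ == b').
have bcE b' c : law (run_law M (uniform_bits R T))
    (fun w => (input_at t w, mem_before t w)) (b', c) = m c / 2.
  rewrite [RHS](_ : _ = \sum_a m c / 2 * step M t c b' a); last first.
    by rewrite -mulr_sumr fdist_sum1 mulr1.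
  rewrite lawE (partition_big (mem_after t) predT) //=.
  apply: eq_bigr => a _; rewrite -abcE lawE; apply: eq_bigl => w.
  rewrite !xpair_eqE.
  by case: (_ == a); case: (_ == c); case: (_ == b').
have cE c : law (run_law M (uniform_bits R T)) (mem_before t) c = m c.
  exact: lawE.
rewrite /cond_mutual_info.
under eq_bigr => a _ do under eq_bigr => b' _ do under eq_bigr => c _ do
  rewrite abcE acE bcE cE /=.
have m0 c : 0 <= m c by exact: mu_ge0 fair_ge0.
apply: le_trans (ler_sum _ (fun a _ => ler_sum _ (fun b' _ => ler_sum _
  (fun c _ => info_term_ge (m0 c) (mean_step_ge0 t c a)
     (fdist_ge0 (step M t c b') a) (step_le_mean t c b' a))))).
under eq_bigr => a _ do rewrite exchange_big /=.
rewrite exchange_big mulr_suml; apply: ler_sum => c _ /=.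
rewrite mulr_sumr mulr_suml; apply: ler_sum => a _.
rewrite -mulr_suml -mulr_sumr.
(* The two bits deviate from their mean by opposite amounts: the linear terms cancel and the squares
   agree, whichever [b] is chosen. *)
have -> : \sum_b' (step M t c b' a - mean_step t c a +
     (step M t c b' a - mean_step t c a) ^+ 2 / mean_step t c a / 6)
   = 2 * ((step M t c b a - mean_step t c a) ^+ 2 / mean_step t c a / 6).
  set p := mean_step t c a; have pE : p = 2^-1 * step M t c true a
    + 2^-1 * step M t c false a by rewrite /p /mean_step big_bool.
  rewrite big_bool /=; case: b.
    have -> : step M t c false a = 2 * p - step M t c true a by lra.
    ring.
  have -> : step M t c true a = 2 * p - step M t c false a by lra.
  ring.
set y := _ / mean_step t c a.
have y0 : 0 <= y by rewrite divr_ge0 ?sqr_ge0 ?mean_step_ge0.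
rewrite -/(m c) ler_pdivlMr ?ln2_gt0 //.
have -> : m c / 2 * (2 * (y / 6)) = m c * y / 6 by field.
(* Measuring in bits divides by [ln 2 <= 1], which only helps. *)
by rewrite ler_piMr ?ln2_le1 // divr_ge0 // mulr_ge0.
Qed.

Lemma info_cost_ge b : (\sum_t chi_cost b t) / 6 <= info_cost M.
Proof.
by rewrite mulr_suml; apply: ler_sum => t _; exact: cond_mutual_info_ge.
Qed.

Lemma info_cost_ge0 : 0 <= info_cost M.
Proof.
apply: le_trans (info_cost_ge true); rewrite divr_ge0 // sumr_ge0 // => t _.
exact: chi_cost_ge0.
Qed.

Lemma output_itv c : 0 <= output M c Struct <= 1.
Proof.
rewrite fdist_ge0 /= -(fdist_sum1 (output M c)) (bigD1 Struct) //= lerDl.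
by apply: sumr_ge0 => v _; exact: fdist_ge0.
Qed.

Lemma advantage_le1 : advantage M <= 1.
Proof.
rewrite advantageE big_bool /=.
have le1 b : \sum_c mu (const b) ord_max c * output M c Struct <= 1.
  apply: (@le_trans _ _ (\sum_c mu (const b) ord_max c)); last first.
    by rewrite mu_sum1 // sum_const.
  apply: ler_sum => c _.
  by have /andP[_ o1] := output_itv c; rewrite ler_piMr // mu_ge0 // => b'; exact: const_ge0.
have ge0 : 0 <= \sum_c mu fair ord_max c * output M c Struct.
  apply: sumr_ge0 => c _; have /andP[o0 _] := output_itv c.
  by rewrite mulr_ge0 // mu_ge0 //; exact: fair_ge0.
have := le1 true; have := le1 false; lra.
Qed.

(** The advantage averages the gaps of the two constant streams, each at most
    [4 * l * V + (8 * l)^-1] with V at most 6 times the cost. *)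
Lemma advantage_le l : 0 < l -> advantage M <= 24 * l * info_cost M + (8 * l)^-1.
Proof.
move=> l0.
suff gap b : \sum_c mu (const b) ord_max c * output M c Struct
    - \sum_c mu fair ord_max c * output M c Struct
    <= 24 * l * info_cost M + (8 * l)^-1.
  by rewrite advantageE big_bool /=; have := gap true; have := gap false; lra.
have V_le := info_cost_ge b.
apply: (@le_trans _ _ (4 * l * (\sum_t chi_cost b t) + (8 * l)^-1)).
  apply: test_gap; rewrite ?mu_sum1 ?sum_fair ?sum_const //.
  - by move=> c; exact: mu_ge0 fair_ge0.
  - by move=> c; apply: mu_ge0; exact: const_ge0.
  - exact: output_itv.
  - have := harmonic_states_ge b ord_max.
    by rewrite (eq_bigl predT) // => t; rewrite ltn_ord.
rewrite lerD2r; have := ler_wpM2l (ltW l0) V_le; lra.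
Qed.
End OneBit.

Theorem theorem4 (R : realType) (T : nat) (hT : (1 <= T)%N)
    (delta : R) (hdelta : 0 <= delta)
    (Mem : finType) (M : streaming_algorithm R bool Mem verdict T)
    (hadv : delta <= advantage M) :
  delta ^+ 4 / 40%:R <= info_cost M.
Proof.
have [->|dN0] := eqVneq delta 0.
  by rewrite expr0n mul0r info_cost_ge0.
have d0 : 0 < delta by rewrite lt0r dN0.
have d1 : delta <= 1 := le_trans hadv (advantage_le1 M).
(* With [l = (4 * delta)^-1] the error term is [delta / 2], leaving
   [delta ^+ 2 <= 12 * info_cost M]. *)
have l0 : 0 < (4 * delta)^-1 by rewrite invr_gt0 mulr_gt0.
have := le_trans hadv (advantage_le M l0).
have -> : (8 * (4 * delta)^-1)^-1 = delta / 2 by field.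
have -> : 24 * (4 * delta)^-1 * info_cost M = 6 * info_cost M / delta by field.
rewrite -lerBlDr ler_pdivlMr // => h.
have d21 : delta ^+ 2 <= 1 by rewrite expr_le1.
(* As [delta <= 1], the fourth power is below the square, and 12 is below 40. *)
have := ler_wpM2l (sqr_ge0 delta) d21; rewrite -exprD mulr1; nra.
Qed.
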